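(* Let $H\in\mathrm{Ind}_{N_n}^{G_n}\psi_k$. Suppose that $\sum_{x\in N_n\backslash G_n}H(x)W(x)=0$ for every $W\in\mathcal{W}(P(\pi),\psi_{R(\pi)}^{-1})$ and every irreducible generic $k$-representation $\pi$ of $G_n$. Then $H$ is identically zero.
   Context: Let $p$ be a prime, $q$ a power of $p$, $G_n=\mathrm{GL}_n(\mathbb{F}_q)$, $\ell\neq p$ a prime, $k=\overline{\mathbb{F}}_\ell$. Fix a nontrivial $\psi:(\mathbb{F}_q,+)\to k^\times$, viewed as a character $\psi_k$ of the upper unipotent subgroup $N_n$ via $u\mapsto\psi(\sum_iu_{i,i+1})$; $\mathrm{Ind}_{N_n}^{G_n}\psi_k=\{f:G_n\to k: f(ug)=\psi_k(u)f(g)\}$. An irreducible $k$-representation is generic if its $(N_n,\psi_k)$-coinvariants are nonzero (equivalently, its $(N_n,\psi_k^{-1})$-coinvariants are nonzero). For such $\pi$, $P(\pi)$ is its projective cover as a $k[G_n]$-module and $R(\pi)=\mathrm{End}_{k[G_n]}(P(\pi))$ (a commutative local finite-dimensional $k$-algebra acting on $P(\pi)$); the $(N_n,\psi^{-1})$-coinvariants of $P(\pi)$ form a free $R(\pi)$-module of rank one, and choosing a generator $\lambda$ of its $R(\pi)$-dual gives an $R(\pi)[G_n]$-map $P(\pi)\to\{W:G_n\to R(\pi):W(ug)=\psi^{-1}(u)W(g)\}$, $f\mapsto(g\mapsto\lambda(\overline{gf}))$, whose image is $\mathcal{W}(P(\pi),\psi^{-1}_{R(\pi)})$. The sum in the claim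 is computed in $R(\pi)\supset k$. *)

(* Defs.v *)
From HB Require Import structures.
From mathcomp Require Import all_boot all_order all_algebra all_fingroup.
From mathcomp Require Import all_field mxrepresentation.
Set Implicit Arguments.
Unset Strict Implicit.
Unset Printing Implicit Defensive.
Import GRing.Theory.
Local Open Scope ring_scope.

(* G_n = GL_n(F_q) is {'GL_n[F]} (for 0 < n its matrices are n x n).  *)

Definition unipN (F : finFieldType) (n : nat) : {set {'GL_n[F]}} :=
  [set u : {'GL_n[F]} | [forall i : 'I_n.-1.+1, [forall j : 'I_n.-1.+1,
      ((j < i)%N ==> (GLval u i j == 0)) && ((i == j) ==> (GLval u i j == 1))]]].

Definition psiN (F : finFieldType) (k : fieldType) (psi : F -> k) (n : nat)
    (u : {'GL_n[F]}) : k :=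
  psi (\sum_(i < n.-1) GLval u (inord i) (inord i.+1)).

Definition in_Ind (F : finFieldType) (k : fieldType) (psi : F -> k) (n : nat)
    (H : {'GL_n[F]} -> k) : Prop :=
  forall u g, u \in unipN F n -> H (u * g)%g = psiN psi u * H g.

(* k[G]-modules.  A (left) k[G]-module of dimension d is modelled by a *)
(* MathComp matrix representation rV : mx_representation k G d on row  *)
(* vectors; the LEFT action of g on v is  v *m rV g^-1.  Submodules,    *)
(* irreducibility, homomorphisms, endomorphisms and projectivity are    *)
(* the same for the left action and for MathComp's right action.        *)
Section Modules.
Variables (k : fieldType) (gT : finGroupType).
Local Notation G := [set: gT].

Definition lact d (rV : mx_representation k G d) (g : gT) (v : 'rV[k]_d) :
  'rV[k]_d := v *m rV g^-1%g.

Definition is_ghom m d (rM : mx_representation k G m)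
    (rV : mx_representation k G d) (f : 'M[k]_(m, d)) : Prop :=
  forall g, rM g *m f = f *m rV g.

Definition projective_mod m (rP : mx_representation k G m) : Prop :=
  forall d (rM : mx_representation k G d) (f : 'M[k]_(d, m)),
    is_ghom rM rP f -> row_full f ->
    exists s : 'M[k]_(m, d), is_ghom rP rM s /\ s *m f = 1%:M.

Definition projective_cover d (rV : mx_representation k G d)
    m (rP : mx_representation k G m) (phi : 'M[k]_(m, d)) : Prop :=
  [/\ projective_mod rP, is_ghom rP rV phi, row_full phi &
      forall U : 'M[k]_m, mxmodule rP U ->
        (U + kermx phi == 1%:M)%MS -> row_full U].

(* R(pi) = End_{k[G]}(P): matrices commuting with the action.  An       *)
(* endomorphism A acts on P by v |-> v *m A; composition r o s in R is  *)
(* the matrix s *m r.                                                   *)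
Definition End_mod m (rP : mx_representation k G m) (A : 'M[k]_m) : Prop :=
  centgmx rP A.

End Modules.

Section Whittaker.
Variables (F : finFieldType) (k : fieldType) (psi : F -> k) (n : nat).
Local Notation gT := {'GL_n[F]}.
Local Notation G := [set: gT].

(* Generic: the (N_n, psi_k)-coinvariants V / span{u.v - psi_k(u) v}   *)
(* are nonzero.                                                          *)
Definition generic d (rV : mx_representation k G d) : bool :=
  (\rank ((\sum_(u in unipN F n) (rV u^-1%g - (psiN psi u)%:M)%R)%MS) < d)%N.

(* lam : P -> R(pi) is an R(pi)-linear form on P which factors through  *)
(* the (N_n, psi^{-1})-coinvariants, i.e. an element of the R(pi)-dual   *)
(* of the coinvariants P_{N_n, psi^{-1}}.                                 *)
Definition coinv_form m (rP : mx_representation k G m)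
    (lam : 'rV[k]_m -> 'M[k]_m) : Prop :=
  [/\ forall f, End_mod rP (lam f),
      forall f f', lam (f + f') = lam f + lam f',
      forall f A, End_mod rP A -> lam (f *m A) = lam f *m A &
      forall u f, u \in unipN F n ->
        lam (lact rP u f) = (psiN psi u)^-1 *: lam f].

Definition coinv_dual_generator m (rP : mx_representation k G m)
    (lam : 'rV[k]_m -> 'M[k]_m) : Prop :=
  coinv_form rP lam /\
  forall mu, coinv_form rP mu ->
    exists A, End_mod rP A /\ forall f, mu f = lam f *m A.

Definition whittaker m (rP : mx_representation k G m)
    (lam : 'rV[k]_m -> 'M[k]_m) (f : 'rV[k]_m) (g : gT) : 'M[k]_m :=
  lam (lact rP g f).

End Whittaker.

(* Main.v *)
(* Let e be the idempotent of k[G] projecting onto (N, psi)-equivariants and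
   h = sum_g H(g) g^-1, so that h e = h.  If e y h = 0 for every y in G, the
   coefficient of 1 in e y h is H(y), whence H = 0; so it suffices to prove
   e k[G] h = 0.  By the Gelfand-Graev theorem (Bruhat decomposition and the
   anti-involution g |-> w0 g^T w0) the Hecke algebra e k[G] e is commutative.
   If e' is a primitive idempotent of it, e' k[G] has the local endomorphism ring
   e' k[G] e' and is the projective cover of a generic irreducible module; by
   commutativity f |-> (left multiplication by f e) generates the dual of its
   coinvariants, and for this form the orthogonality relation says e' k[G] h = 0.
   Finally e is a sum of orthogonal primitive idempotents. *)
Require Import Defs.
From HB Require Import structures.
From mathcomp Require Import all_boot all_order all_algebra all_fingroup.
From mathcomp Require Import all_solvable.
From mathcomp Require Import all_field mxrepresentation.
From mathcomp Require Import zify.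
From Stdlib Require Import Classical.
Set Implicit Arguments.
Unset Strict Implicit.
Unset Printing Implicit Defensive.
Import GRing.Theory.
Local Open Scope ring_scope.

(** * The regular representation and its commutant *)

(** Modules are row spaces, so G acts on k[G] by right multiplication, and the matrices commuting
    with it are the left multiplications, composed in reversed order. Hecke elements are handled as
    such matrices throughout. The orthogonality hypothesis ranges over all covers and all generators
    of the dual, so it can be fed the explicit module e' k[G] and an explicit form on it.
    Commutativity is used repeatedly: it lets Fitting's argument produce an idempotent inside the
    corner, it makes the endomorphism ring of e' k[G] commutative, and it gives (x e) e' = x e for x
    in e' k[G], which allows a form to be evaluated at e' without losing information. There is a
    mismatch of characters. With the left action [v *m rV g^-1], the vectors fixed by e transform
    under N by the inverse of psi, as the Whittaker forms require, whereas [generic] is phrased with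
    psi itself; a diagonal matrix of alternating signs bridges the two. The idempotent e exists
    because |N| is a power of p, hence invertible in characteristic l. *)

Section Representations.
Variables (k : fieldType) (gT : finGroupType).
Local Notation G := [set: gT]%G.

(** Provides the irreducible head of a module that is to become a projective cover: nonzero proper
    submodules are factored out until none is left. *)
Lemma irreducible_quotient m (rP : mx_representation k G m) : (0 < m)%N ->
  exists d (rV : mx_representation k G d) (phi : 'M[k]_(m, d)),
    [/\ mx_irreducible rV, is_ghom rP rV phi & row_full phi].
Proof.
have [M] := ubnP m; elim: M m rP => // M IH m rP ltmM m_gt0.
case: (classic (mx_irreducible rP)) => [irrP | nirrP].
  exists m, rP, 1%:M; split=> // [g|]; first by rewrite mulmx1 mul1mx.
  by rewrite row_full_unit unitmx1.
have [U [Umod nzU ltU]] : exists U : 'M_m,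
    [/\ mxmodule rP U, U != 0 & (\rank U < m)%N].
  apply: NNPP => nexU; apply: nirrP; apply/mx_irrP; split=> // U Umod nzU.
  rewrite -col_leq_rank leqNgt; apply/negP=> ltU; apply: nexU; by exists U.
have rkC : \rank (cokermx U) = (m - \rank U)%N by rewrite mxrank_coker.
have [||d [rV [phi [irrV homphi fullphi]]]] :=
  IH _ (factmod_repr Umod).
- rewrite rkC; apply: leq_trans (ltmM : (m <= M)%N).
  by rewrite ltn_subrL m_gt0 lt0n mxrank_eq0 nzU.
- by rewrite rkC subn_gt0.
exists d, rV, (in_factmod U 1%:M *m phi); split=> // [g|].
  rewrite mulmxA -in_factmodE -[rP g]mul1mx in_factmodJ ?inE //.
  by rewrite -(mulmxA _ (factmod_repr Umod g)) homphi mulmxA.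
have /row_fullP[P2 P2K] := fullphi.
apply/row_fullP; exists (P2 *m val_factmod 1%:M).
by rewrite -mulmxA (mulmxA (val_factmod _)) -in_factmodE val_factmodK mul1mx.
Qed.

Lemma gring_mx_sum m (rP : mx_representation k G m) w :
  gring_mx rP w = \sum_i w 0 i *: rP (enum_val i).
Proof.
rewrite /gring_mx /= mulmx_sum_row linear_sum; apply: eq_bigr => i _.
by rewrite linearZ /= rowK mxvecK.
Qed.

Lemma gring_mx_ghom m d (rP : mx_representation k G m)
    (rV : mx_representation k G d) phi w :
  is_ghom rP rV phi -> gring_mx rP w *m phi = phi *m gring_mx rV w.
Proof.
move=> homphi; rewrite !gring_mx_sum mulmx_suml mulmx_sumr.
by apply: eq_bigr => i _; rewrite -scalemxAl -scalemxAr homphi.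
Qed.

Local Notation nG := #|G|.
Local Notation aG := (regular_repr k G).

Definition gdelta (x : gT) : 'rV[k]_nG := delta_mx 0 (gring_index G x).

Lemma gdelta_repr x y : gdelta x *m aG y = gdelta (x * y).
Proof. by rewrite -rowE rowK gring_indexK ?inE. Qed.

Lemma eq_on_gdelta m (A B : 'M[k]_(nG, m)) :
  (forall x, gdelta x *m A = gdelta x *m B) -> A = B.
Proof.
move=> eqAB; apply/row_matrixP=> i.
by rewrite !rowE -[i](gring_valK i) eqAB.
Qed.

(** Left multiplication by [v] in k[G]: since [gring_mx aG w] is right multiplication by [w], the
    row [w] goes to the product v w. *)
Definition lmul (v : 'rV[k]_nG) : 'M[k]_nG :=
  lin1_mx (mulmx v \o gring_mx aG).

Lemma mul_lmul v w : w *m lmul v = v *m gring_mx aG w.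
Proof. by rewrite mul_rV_lin1. Qed.

Lemma gring_gdelta m (rP : mx_representation k G m) x :
  gring_mx rP (gdelta x) = rP x.
Proof.
rewrite gring_mx_sum (bigD1 (gring_index G x)) //= mxE !eqxx scale1r.
rewrite gring_indexK ?inE // big1 ?addr0 // => i ne.
by rewrite mxE (negPf ne) andbF scale0r.
Qed.

Lemma gdelta_lmul x v : gdelta x *m lmul v = v *m aG x.
Proof. by rewrite mul_lmul gring_gdelta. Qed.

Lemma gdelta1_lmul v : gdelta 1 *m lmul v = v.
Proof. by rewrite gdelta_lmul repr_mx1 mulmx1. Qed.

Definition commutes m (A : 'M[k]_m) (rP : mx_representation k G m) :=
  forall g, A *m rP g = rP g *m A.

Lemma lmul_comm v : commutes (lmul v) aG.
Proof.
move=> g; apply: eq_on_gdelta => x.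
by rewrite !mulmxA gdelta_repr !gdelta_lmul repr_mxM ?inE // mulmxA.
Qed.

(** The identity generates the regular module, so a commuting matrix is determined by its value
    there. *)
Lemma eq_gdelta1 A B : commutes A aG -> commutes B aG ->
  gdelta 1 *m A = gdelta 1 *m B -> A = B.
Proof.
move=> cA cB eqAB; apply: eq_on_gdelta => x.
rewrite -[x]mul1g -gdelta_repr -!mulmxA -cA -cB.
by rewrite !mulmxA eqAB.
Qed.

Lemma lmulK A : commutes A aG -> lmul (gdelta 1 *m A) = A.
Proof.
move=> cA; apply: eq_gdelta1 => //; first exact: lmul_comm.
exact: gdelta1_lmul.
Qed.

Lemma commutesM m (rP : mx_representation k G m) A B :
  commutes A rP -> commutes B rP -> commutes (A *m B) rP.
Proof. by move=> cA cB g; rewrite -mulmxA cB mulmxA cA mulmxA. Qed.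

Lemma lmul_mul A v : commutes A aG -> lmul (v *m A) = lmul v *m A.
Proof.
move=> cA; apply: eq_gdelta1; first exact: lmul_comm.
  by apply: commutesM => //; apply: lmul_comm.
by rewrite mulmxA !gdelta1_lmul.
Qed.

End Representations.

(** * The Hecke algebra and its projective indecomposables *)

Section Hecke.
Variables (k : fieldType) (gT : finGroupType).
Local Notation G := [set: gT]%G.
Local Notation nG := #|G|.
Local Notation aG := (regular_repr k G).
Local Notation d1 := (gdelta k (1%g : gT)).
Variables (N : {group gT}) (chi : gT -> k).
Hypothesis chiM : {in N &, forall u v, chi (u * v)%g = chi u * chi v}.
Hypothesis chi_neq0 : forall u, u \in N -> chi u != 0.
Hypothesis cardN_neq0 : (#|N|%:R : k) != 0.

(** The action of e on any module. For the left action [v *m rP u^-1], its image is the subspace on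
    which N acts by the inverse of [chi]. *)
Definition whit_op m (rP : mx_representation k G m) : 'M[k]_m :=
  (#|N|%:R)^-1 *: \sum_(u in N) (chi u)^-1 *: rP u.

Local Notation eps := (whit_op aG).
(** [eps] is right multiplication by e and need not commute with [aG]; this is left multiplication
    by the same element. *)
Definition whit_idem : 'M[k]_nG := lmul (d1 *m eps).
Local Notation E0 := whit_idem.

Lemma chi1 : chi 1%g = 1.
Proof.
have := chiM (group1 N) (group1 N); rewrite mulg1 -{1}[chi 1%g]mulr1.
by move/(mulfI (chi_neq0 (group1 N))).
Qed.

Lemma chiV u : u \in N -> chi u^-1%g = (chi u)^-1.
Proof.
move=> Nu; apply: (mulfI (chi_neq0 Nu)); rewrite -chiM ?groupV // mulgV chi1.
by rewrite mulfV ?chi_neq0.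
Qed.

Section WhitOp.
Variables (m : nat) (rP : mx_representation k G m).

Lemma whit_opJ u : u \in N -> rP u *m whit_op rP = chi u *: whit_op rP.
Proof.
move=> Nu; rewrite -scalemxAr scalerA mulrC -scalerA; congr (_ *: _).
rewrite mulmx_sumr scaler_sumr (reindex_inj (mulgI u^-1%g)) /=.
rewrite (eq_bigl (mem N)) => [|v]; last by rewrite groupMl ?groupV.
apply: eq_bigr => v Nv; rewrite -scalemxAr -repr_mxM ?inE // mulKVg scalerA.
by rewrite chiM ?groupV // chiV // invfM invrK.
Qed.

Lemma whit_op_id : whit_op rP *m whit_op rP = whit_op rP.
Proof.
rewrite {1}/whit_op -scalemxAl mulmx_suml.
rewrite (eq_bigr (fun _ => whit_op rP)) => [|u Nu]; last first.
  by rewrite -scalemxAl whit_opJ // scalerA mulVf ?scale1r ?chi_neq0.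
by rewrite sumr_const -scaler_nat scalerA mulVf ?scale1r.
Qed.

Lemma whit_op_ghom n (rV : mx_representation k G n) phi :
  is_ghom rP rV phi -> whit_op rP *m phi = phi *m whit_op rV.
Proof.
move=> homphi; rewrite -scalemxAl -scalemxAr mulmx_suml mulmx_sumr.
congr (_ *: _); apply: eq_bigr => u _.
by rewrite -scalemxAl -scalemxAr homphi.
Qed.

End WhitOp.

Lemma whit_idem_comm : commutes E0 aG.
Proof. exact: lmul_comm. Qed.

Lemma gdelta1_whit : d1 *m E0 = d1 *m eps.
Proof. exact: gdelta1_lmul. Qed.

Lemma commutes_whit_op m (rP : mx_representation k G m) A :
  commutes A rP -> A *m whit_op rP = whit_op rP *m A.
Proof. by move=> cA; rewrite -(@whit_op_ghom _ rP _ rP A). Qed.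

Lemma whit_idemM : E0 *m E0 = E0.
Proof.
apply: eq_gdelta1; [apply: commutesM; apply: lmul_comm|exact: lmul_comm|].
rewrite mulmxA gdelta1_whit -mulmxA -commutes_whit_op; last exact: lmul_comm.
by rewrite mulmxA gdelta1_whit -mulmxA whit_op_id.
Qed.

(** The left multiplications by elements of e k[G] e, that is, the endomorphisms of the
    Gelfand-Graev module e k[G]. *)
Definition hecke (A : 'M[k]_nG) :=
  [/\ commutes A aG, E0 *m A = A & A *m E0 = A].

Lemma heckeM A B : hecke A -> hecke B -> hecke (A *m B).
Proof.
case=> cA lA rA [cB lB rB]; split; first exact: commutesM.
  by rewrite mulmxA lA.
by rewrite -mulmxA rB.
Qed.

Lemma heckeB A B : hecke A -> hecke B -> hecke (A - B).
Proof.
case=> cA lA rA [cB lB rB]; split=> [g||]; first by rewrite mulmxBl cA cB mulmxBr.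
  by rewrite mulmxBr lA lB.
by rewrite mulmxBl rA rB.
Qed.

Lemma hecke_id : hecke E0.
Proof. by split; rewrite ?whit_idemM //; apply: whit_idem_comm. Qed.

Hypothesis hecke_mulC : forall A B, hecke A -> hecke B -> A *m B = B *m A.

(** A rank factorisation splits an idempotent: cancelling the full-rank outer factors from a b a b =
    a b leaves b a = 1. This gives the row space of [E] coordinates of its own. *)
Lemma idem_base n (E : 'M[k]_n) : E *m E = E ->
  exists r (a : 'M_(n, r)) (b : 'M_(r, n)), a *m b = E /\ b *m a = 1%:M.
Proof.
move=> EE; exists (\rank E), (col_base E), (row_base E).
split; first exact: mulmx_base.
have /row_fullP[a' a'K] := col_base_full E.
have /row_freeP[b' bK] := row_base_free E.
move: (mulmx_base E) a'K bK; move: (col_base E) (row_base E) => a b abE a'K bK.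
have : a *m (b *m a) *m b = a *m b by rewrite mulmxA abE -mulmxA abE.
move/(congr1 (fun X => a' *m X *m b')) => /=.
by rewrite !mulmxA a'K mul1mx -(mulmxA _ b) bK mulmx1.
Qed.

(** * The projective cover and the Whittaker form cut out by a primitive idempotent *)

Section LocalAlgebra.
Variable E : 'M[k]_nG.
Hypotheses (hE : hecke E) (EE : E *m E = E).
Hypothesis Eprim : forall X, hecke X -> E *m X = X -> X *m X = X ->
  X = 0 \/ X = E.

Lemma hecke_cut A : commutes A aG -> hecke (E *m A *m E).
Proof.
case: hE => cE lE rE cA; split.
- by apply: commutesM => //; apply: commutesM.
- by rewrite !mulmxA lE.
- by rewrite -mulmxA rE.
Qed.

(* Fitting: for m large X^m = Y X^2m, so Y X^m is an idempotent of the
   commutative algebra E Hecke E, hence 0 or E. *)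
Lemma hecke_local X : hecke X -> E *m X = X ->
  exists2 Y, hecke Y & X *m Y = E \/ (E - X) *m Y = E.
Proof.
move=> hX EX; have [cX lX rX] := hX; have [cE lE rE] := hE.
have XE : X *m E = X by rewrite hecke_mulC.
have hXn i : hecke (X ^+ i.+1).
  elim: i => [|i IH]; first by rewrite expr1.
  by rewrite exprS; apply: heckeM.
have EXn i : E *m X ^+ i.+1 = X ^+ i.+1 by rewrite exprS mulmxA EX.
have rkS i : (\rank (X ^+ i.+1) <= \rank (X ^+ i))%N.
  by rewrite exprS mxrankM_maxr.
have [m eqm] : exists m, \rank (X ^+ m.+1) = \rank (X ^+ m.+2).
  apply: NNPP => nex.
  have dec m : (\rank (X ^+ m.+1) + m <= nG)%N.
    elim: m => [|m IH]; first by rewrite addn0 rank_leq_row.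
    rewrite addnS; apply: leq_trans IH; rewrite ltn_add2r ltn_neqAle rkS andbT.
    by apply/eqP=> e; apply: nex; exists m.
  by have := dec nG.+1; rewrite addnS leqNgt ltnS leq_addl.
have le1 : (X ^+ m.+1 <= X ^+ m.+2)%MS.
  have := mxrank_leqif_sup (_ : (X ^+ m.+2 <= X ^+ m.+1)%MS).
  by rewrite {2}exprS submxMl -eqm => /(_ isT) [_]; rewrite eqxx.
have leS j : (X ^+ m.+1 <= X ^+ (m.+1 + j))%MS.
  elim: j => [|j IH]; first by rewrite addn0.
  rewrite addnS; apply: submx_trans le1 _.
  by rewrite (exprSr X m.+1) (exprSr X (m.+1 + j)); apply: submxMr.
(* Inclusion of row spaces yields a multiplier with no equivariance. Taken on the identity row only,
   it is the vector [z], and [lmul z] is an equivariant multiplier. *)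
have /submxP[z Dz] : (d1 *m X ^+ m.+1 <= X ^+ (m.+1 + m.+1))%MS.
  exact: submx_trans (submxMl _ _) (leS _).
have DX : lmul z *m X ^+ (m.+1 + m.+1) = X ^+ m.+1.
  have [c1 _ _] := hXn (m + m.+1)%N; have [c2 _ _] := hXn m.
  by rewrite -lmul_mul // -Dz lmulK.
pose Y := E *m lmul z *m E.
have hY : hecke Y by apply: hecke_cut; apply: lmul_comm.
have YX : Y *m X ^+ (m.+1 + m.+1) = X ^+ m.+1.
  by rewrite -!mulmxA (EXn (m + m.+1)%N) DX.
have EY : E *m Y = Y by rewrite !mulmxA EE.
clearbody Y; pose f := Y *m X ^+ m.+1.
have hf : hecke f by apply: heckeM.
have Xf : X ^+ m.+1 *m f = X ^+ m.+1.
  by rewrite hecke_mulC // /f -mulmxA -[X ^+ _ *m _]exprD.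
have ff : f *m f = f by rewrite {1}/f -mulmxA Xf.
have Ef : E *m f = f by rewrite mulmxA EY.
case: (Eprim hf Ef ff) => f0.
  have Xm0 : X ^+ m.+1 = 0 by rewrite -Xf f0 mulmx0.
  (* [X] is nilpotent, so a geometric series inverts [E - X]; cutting by [E] on both sides brings
     its term X^0 = 1 into the corner. *)
  exists (E *m (\sum_(i < m.+1) X ^+ i) *m E).
    apply: hecke_cut; apply: (big_ind (fun A => commutes A aG)) => [g|A B cA cB g|i _].
    + by rewrite mul0mx mulmx0.
    + by rewrite mulmxDl mulmxDr cA cB.
    case: (val i) => [|j] g; first by rewrite expr0 mul1mx mulmx1.
    by have [c _ _] := hXn j; apply: c.
  right; have DE : E - X = E *m (1 - X) by rewrite mulmxBr EX mulmx1.
  have -> : (E - X) *m (E *m (\sum_(i < m.+1) X ^+ i) *m E)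
    = E *m ((1 - X) *m \sum_(i < m.+1) X ^+ i) *m E.
    rewrite -mulmxA -(mulmxA E) !(mulmxA (E - X)) mulmxBl EE XE.
    by rewrite {1}DE !mulmxA.
  have -> : (1 - X) *m (\sum_(i < m.+1) X ^+ i) = 1.
    by rewrite -opprB mulNmx -[(X - 1) *m _]subrX1 Xm0 sub0r opprK.
  by rewrite [_ *m 1]mulmx1.
exists (Y *m X ^+ m *m E).
  case: (m) => [|j]; first by rewrite expr0 mulmx1; apply: heckeM.
  by apply: heckeM => //; apply: heckeM.
left; rewrite !mulmxA (hecke_mulC hX hY) -(mulmxA Y) -[X *m _]exprS.
by rewrite -/f f0 EE.
Qed.

Variables (r : nat) (a : 'M[k]_(nG, r)) (b : 'M[k]_(r, nG)).
Hypotheses (abE : a *m b = E) (baK : b *m a = 1%:M).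

Lemma idem_col : E *m a = a.
Proof. by rewrite -abE -mulmxA baK mulmx1. Qed.

Lemma idem_row : b *m E = b.
Proof. by rewrite -abE mulmxA baK mul1mx. Qed.

Definition idem_mx (g : gT) := b *m aG g *m a.

Lemma idem_mx_repr : mx_repr G idem_mx.
Proof.
have [cE _ _] := hE.
split=> [|g1 g2 _ _]; first by rewrite /idem_mx repr_mx1 mulmx1 baK.
rewrite /idem_mx repr_mxM ?inE // -!mulmxA (mulmxA a) abE.
by rewrite (mulmxA E) cE -(mulmxA _ E) idem_col.
Qed.
Definition idem_repr := MxRepresentation idem_mx_repr.
Local Notation rP := idem_repr.

Lemma idem_col_ghom : is_ghom aG rP a.
Proof.
have [cE _ _] := hE => g.
by rewrite [rP g]/(b *m aG g *m a) !mulmxA abE cE -mulmxA idem_col.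
Qed.

Lemma idem_row_ghom : is_ghom rP aG b.
Proof.
have [cE _ _] := hE => g.
rewrite [rP g]/(b *m aG g *m a) -!mulmxA abE -cE mulmxA.
by rewrite idem_row.
Qed.

(** [d1 *m a] is e' in the coordinates of the row space, and e' f = f for [f] in e' k[G]: the module
    is cyclic. *)
Lemma idem_gen f : d1 *m a *m gring_mx rP (f *m b) = f.
Proof.
rewrite -mulmxA -(gring_mx_ghom _ idem_col_ghom) mulmxA.
by rewrite -rowE [row _ _]gring_mxK -mulmxA baK mulmx1.
Qed.

(** The module is a direct summand of the regular one: lift the generator through [f], extend the
    lift freely to k[G], and restrict along [b]. *)
Lemma idem_projective : projective_mod rP.
Proof.
move=> d rM f homf /row_fullP[f' f'K].
pose c := d1 *m a *m f'.
have cf : c *m f = d1 *m a by rewrite -mulmxA f'K mulmx1.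
pose S := lin1_mx (mulmx c \o gring_mx rM).
have SE w : w *m S = c *m gring_mx rM w by rewrite mul_rV_lin1.
exists (b *m S); split=> [g|].
  rewrite mulmxA idem_row_ghom -!mulmxA; congr (_ *m _).
  apply: eq_on_gdelta => x; rewrite !mulmxA gdelta_repr !SE !gring_gdelta.
  by rewrite repr_mxM ?inE // mulmxA.
apply/row_matrixP=> i; rewrite !rowE mulmx1; set v := delta_mx _ _.
rewrite !mulmxA SE -mulmxA (gring_mx_ghom _ homf) mulmxA cf.
exact: idem_gen.
Qed.

(** For [x] in e' k[G], the equality e' (x e) = x e is formal; the second conclusion is (x e) e' = x
    e and rests on commutativity. *)
Lemma hecke_lmul x : x *m E = x -> hecke (lmul (x *m eps)) /\
  E *m lmul (x *m eps) = lmul (x *m eps).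
Proof.
have [cE lE rE] := hE => xE.
have cl v : commutes (lmul v) aG by apply: lmul_comm.
have xeE : lmul (x *m eps) *m E = lmul (x *m eps).
  by rewrite -lmul_mul // -mulmxA -commutes_whit_op // mulmxA xE.
have h : hecke (lmul (x *m eps)).
  split; first exact: cl.
    apply: eq_gdelta1 => //; first by apply: commutesM; apply: lmul_comm.
    rewrite mulmxA gdelta1_whit -mulmxA -commutes_whit_op //.
    by rewrite mulmxA gdelta1_lmul -mulmxA whit_op_id.
  by rewrite -{1}xeE -mulmxA rE.
by split=> //; rewrite hecke_mulC.
Qed.

Lemma gdelta1_idem_whit : d1 *m E *m eps = d1 *m E.
Proof.
have [cE lE rE] := hE.
by rewrite -mulmxA commutes_whit_op // mulmxA -gdelta1_whit -mulmxA lE.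
Qed.

Section Cover.
Variables (d : nat) (rV : mx_representation k G d) (phi : 'M[k]_(r, d)).
Hypotheses (irrV : mx_irreducible rV) (homphi : is_ghom rP rV phi).
Hypothesis (fullphi : row_full phi).

Lemma idem_gen_neq0 : d1 *m a *m phi != 0.
Proof.
apply/negP=> /eqP z; have phi0 : phi = 0.
  apply/row_matrixP=> i; rewrite !rowE mulmx0; set f := delta_mx _ _.
  by rewrite -(idem_gen f) -mulmxA (gring_mx_ghom _ homphi) mulmxA z mul0mx.
have /mx_irrP[d_gt0 _] := irrV.
by move: fullphi; rewrite phi0 /row_full mxrank0 eq_sym (gtn_eqF d_gt0).
Qed.

(** Because e' e = e', the generator is fixed by e, and so is its image in the quotient. As that
    image is nonzero, this is the source of genericity. *)
Lemma idem_cover_whit : d1 *m a *m phi *m whit_op rV = d1 *m a *m phi.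
Proof.
rewrite -mulmxA -(whit_op_ghom homphi) mulmxA -(mulmxA d1).
rewrite -(whit_op_ghom idem_col_ghom) -(mulmxA d1) -[in LHS]idem_col.
rewrite -[in RHS]idem_col !mulmxA -(mulmxA d1).
by rewrite -commutes_whit_op ?mulmxA ?gdelta1_idem_whit //; case: hE.
Qed.

(* If x + y = 1 in the local ring E Hecke E, then x or y is invertible; the
   summand whose part of the generator is invertible is everything. *)
Lemma idem_projective_cover : projective_cover rV rP phi.
Proof.
split=> //; first exact: idem_projective.
move=> U Umod /eqmxP sumU.
have [cE lE rE] := hE.
have /sub_addsmxP[[s t] /= Dst] : (d1 *m a <= U + kermx phi)%MS.
  by rewrite sumU submx1.
set x1 := s *m U in Dst; set x2 := t *m kermx phi in Dst.
have x2phi : x2 *m phi = 0 by rewrite -mulmxA mulmx_ker mulmx0.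
have xE (x : 'rV_r) : x *m b *m E = x *m b.
  by rewrite -mulmxA idem_row.
have [h1 E1] := hecke_lmul (xE x1); have [h2 E2] := hecke_lmul (xE x2).
(* The generator is x1 + x2; multiplying by e on the right turns this into a decomposition of the
   unit of the local corner. *)
have D12 : E - lmul (x1 *m b *m eps) = lmul (x2 *m b *m eps).
  rewrite -(lmulK cE) -gdelta1_idem_whit -[in d1 *m E]abE !mulmxA Dst.
  rewrite !mulmxDl; apply: eq_on_gdelta => x.
  rewrite mulmxBr !gdelta_lmul mulmxDl addrC addKr //.
(* If x e is invertible in the corner, the generator is recovered from [x] by the group algebra,
   hence lies in every submodule containing [x]. *)
have key (x : 'rV_r) Y : hecke Y -> hecke (lmul (x *m b *m eps)) ->
    lmul (x *m b *m eps) *m Y = E ->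
    d1 *m a = x *m whit_op rP *m gring_mx rP (d1 *m Y).
  move=> hY hx xY.
  rewrite -[in LHS]idem_col -xY hecke_mulC // !mulmxA mul_lmul.
  rewrite -(mulmxA _ _ a) (gring_mx_ghom _ idem_col_ghom) mulmxA; congr (_ *m _).
  by rewrite -(mulmxA _ _ a) (whit_op_ghom idem_col_ghom) -mulmxA (mulmxA b) baK mul1mx.
have envU (v : 'rV_r) z : (v <= U)%MS ->
    (v *m whit_op rP *m gring_mx rP z <= U)%MS.
  move=> vU; have genU y : (y <= U)%MS -> (y *m gring_mx rP z <= U)%MS.
    exact: mxmodule_envelop Umod (gring_mxP _ _).
  apply: genU; rewrite -scalemxAr scalemx_sub // mulmx_sumr summx_sub // => u _.
  by rewrite -scalemxAr scalemx_sub // (mxmodule_trans Umod) ?inE.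
have [Y hY [Y1|Y2]] := hecke_local h1 E1.
  rewrite -sub1mx; apply/rV_subP=> f _; rewrite -(idem_gen f).
  apply: (mxmodule_envelop Umod (gring_mxP _ _)).
  rewrite (key _ _ hY h1 Y1); apply: envU => //.
  exact: submxMl.
(* Here the generator would be recovered from x2, which [phi] kills. *)
case/eqP: idem_gen_neq0; rewrite D12 in Y2; rewrite (key _ _ hY h2 Y2).
rewrite -mulmxA (gring_mx_ghom _ homphi) mulmxA -(mulmxA x2).
by rewrite (whit_op_ghom homphi) mulmxA x2phi !mul0mx.
Qed.

End Cover.

Lemma idem_row_whit : b *m E0 = b.
Proof. by have [_ _ rE] := hE; rewrite -{1}idem_row -mulmxA rE idem_row. Qed.

Lemma idem_End X : commutes X rP ->
  hecke (a *m X *m b) /\ E *m (a *m X *m b) = a *m X *m b.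
Proof.
have [cE lE rE] := hE => cX; split; last by rewrite !mulmxA idem_col.
split=> [g||].
- rewrite -mulmxA -idem_row_ghom mulmxA -(mulmxA a) cX.
  by rewrite (mulmxA a) -idem_col_ghom !mulmxA.
- by rewrite -idem_col !mulmxA lE.
- by rewrite -mulmxA idem_row_whit.
Qed.

(** The splitting embeds the endomorphism ring in the Hecke algebra by X -> a X b, which is
    multiplicative since b a = 1. *)
Lemma idem_End_mulC X Y : commutes X rP -> commutes Y rP -> X *m Y = Y *m X.
Proof.
move=> cX cY; have [hX _] := idem_End cX; have [hY _] := idem_End cY.
have unfoldM Z W : b *m (a *m Z *m b *m (a *m W *m b)) *m a = Z *m W.
  by rewrite !mulmxA baK mul1mx -(mulmxA Z) baK mulmx1 -mulmxA baK mulmx1.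
by rewrite -unfoldM hecke_mulC // unfoldM.
Qed.

Definition idem_form (f : 'rV[k]_r) : 'M[k]_r :=
  b *m lmul (f *m b *m eps) *m a.
Local Notation lam := idem_form.

Lemma lmulD v w : lmul (v + w) = lmul v + lmul w :> 'M[k]_nG.
Proof.
by apply: eq_on_gdelta => x; rewrite mulmxDr !gdelta_lmul mulmxDl.
Qed.

Lemma lmulZ c v : lmul (c *: v) = c *: lmul v :> 'M[k]_nG.
Proof.
by apply: eq_on_gdelta => x; rewrite -scalemxAr !gdelta_lmul scalemxAl.
Qed.

Lemma idem_formD f f' : lam (f + f') = lam f + lam f'.
Proof. by rewrite /lam !mulmxDl lmulD mulmxDr mulmxDl. Qed.

Lemma idem_formZ c f : lam (c *: f) = c *: lam f.
Proof. by rewrite /lam -!scalemxAl lmulZ -scalemxAr -scalemxAl. Qed.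

Lemma idem_form_comm f : commutes (lam f) rP.
Proof.
move=> g; rewrite -mulmxA -idem_col_ghom mulmxA -(mulmxA b) lmul_comm.
by rewrite (mulmxA b) -idem_row_ghom !mulmxA.
Qed.

Lemma idem_formM f A : commutes A rP -> lam (f *m A) = lam f *m A.
Proof.
move=> cA; have [[cAb _ _] _] := idem_End cA.
rewrite /lam -[in LHS](mulmx1 f) -baK.
have -> : f *m (b *m a) *m A *m b *m eps = f *m b *m eps *m (a *m A *m b).
  by rewrite -(mulmxA _ eps) -commutes_whit_op // !mulmxA.
by rewrite lmul_mul // -!mulmxA baK mulmx1.
Qed.

Lemma idem_formJ u f : u \in N -> lam (f *m rP u) = chi u *: lam f.
Proof.
move=> Nu; rewrite /lam -(mulmxA f) idem_row_ghom.
have -> : f *m (b *m aG u) *m eps = chi u *: (f *m b *m eps).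
  by rewrite !mulmxA -(mulmxA _ (aG u)) whit_opJ // scalemxAr.
by rewrite lmulZ -scalemxAr -scalemxAl.
Qed.

(* mu f = mu (f eps), and f eps is the image of the generator u0 under the
   endomorphism lam f, so mu f = mu u0 o lam f. *)
Lemma idem_form_gen mu :
    (forall f, commutes (mu f) rP) ->
    (forall f f', mu (f + f') = mu f + mu f') ->
    (forall f A, commutes A rP -> mu (f *m A) = mu f *m A) ->
    (forall u f, u \in N -> mu (f *m rP u) = chi u *: mu f) ->
  exists2 A, commutes A rP & forall f, mu f = lam f *m A.
Proof.
move=> muR muD muM muJ; exists (mu (d1 *m a)) => // f.
(* Scalar matrices are endomorphisms, so homogeneity over k is a case of linearity over the
   endomorphism ring. *)
have muZ c v : mu (c *: v) = c *: mu v.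
  rewrite -mul_mx_scalar muM ?mul_mx_scalar // => g.
  by rewrite mul_scalar_mx mul_mx_scalar.
have mu0 : mu 0 = 0 by rewrite -(scale0r 0) muZ scale0r.
have mu_eps : mu (f *m whit_op rP) = mu f.
  rewrite -scalemxAr muZ mulmx_sumr (big_morph mu muD mu0).
  rewrite (eq_bigr (fun _ => mu f)) => [|u Nu]; last first.
    by rewrite -scalemxAr muZ muJ // scalerA mulVf ?scale1r ?chi_neq0.
  by rewrite sumr_const -scaler_nat scalerA mulVf ?scale1r.
rewrite (idem_End_mulC _ (muR _)); last exact: idem_form_comm.
rewrite -muM; last exact: idem_form_comm.
rewrite -{1}mu_eps; congr mu; rewrite /lam.
have fbE : f *m b *m E = f *m b by rewrite -mulmxA idem_row.
have [_ EB] := hecke_lmul fbE.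
rewrite !mulmxA -(mulmxA d1) abE -(mulmxA d1) EB gdelta1_lmul.
by rewrite -(mulmxA _ _ a) (whit_op_ghom idem_col_ghom) mulmxA -(mulmxA f) baK mulmx1.
Qed.

Variable H : gT -> k.
Hypothesis HN : forall u g, u \in N -> H (u * g)%g = chi u * H g.
Local Notation Hop := (\sum_g H g *: aG g^-1%g).

(** By linearity the sum is the form at f h, so left multiplication by f h e vanishes on e' k[G].
    Its value at e' is f h e, since e' is absorbed on the right, and h e = h. *)
Lemma idem_form_orth :
  (forall f, \sum_g H g *: lam (f *m rP g^-1%g) = 0) -> E *m Hop = 0.
Proof.
have [cE _ _] := hE => orth.
have HopE : Hop *m E = E *m Hop.
  rewrite mulmx_suml mulmx_sumr; apply: eq_bigr => g _.
  by rewrite -scalemxAl -scalemxAr cE.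
have Hope : Hop *m eps = Hop.
  rewrite -scalemxAr mulmx_sumr.
  rewrite (eq_bigr (fun _ => Hop)) => [|u Nu]; last first.
    rewrite -scalemxAr mulmx_suml scaler_sumr (reindex_inj (mulgI u)) /=.
    apply: eq_bigr => g _; rewrite -scalemxAl scalerA HN // mulrA.
    by rewrite mulVf ?chi_neq0 // mul1r -repr_mxM ?inE // invMg mulgKV.
  by rewrite sumr_const -scaler_nat scalerA mulVf ?scale1r.
have lam0 : lam 0 = 0 by rewrite -(scale0r 0) idem_formZ scale0r.
have bH0 : b *m Hop = 0.
  apply/row_matrixP=> i; rewrite !rowE mulmx0; set f := delta_mx _ _.
  rewrite mulmxA; set x := f *m b *m Hop.
  have xE : x *m E = x by rewrite -mulmxA HopE mulmxA -(mulmxA f) idem_row.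
  have [hB EB] := hecke_lmul xE; have [cB lB rB] := hB.
  have : lam (x *m a) = 0.
    rewrite -(orth f) -[RHS](_ : lam (\sum_g H g *: (f *m rP g^-1%g)) = _).
      rewrite /x mulmx_sumr mulmx_suml; congr lam; apply: eq_bigr => g _.
      rewrite -scalemxAr -scalemxAl -mulmxA idem_col_ghom -(mulmxA f).
      by rewrite (mulmxA b) baK mul1mx.
    rewrite (big_morph lam idem_formD lam0); apply: eq_bigr => g _.
    exact: idem_formZ.
  rewrite /lam -(mulmxA x) abE xE => /(congr1 (fun X => a *m X *m b)).
  rewrite mulmx0 mul0mx !mulmxA abE EB -mulmxA abE hecke_mulC // EB.
  move/(congr1 (mulmx d1)); rewrite gdelta1_lmul mulmx0.
  by rewrite -mulmxA Hope.
by rewrite -abE -mulmxA bH0 mulmx0.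
Qed.

End LocalAlgebra.

(** * From primitive idempotents to e, and recovery of H *)

(** [coinv_form] for an arbitrary group N and character [chi]; for GL_n the two are convertible. *)
Definition whit_form m (rP : mx_representation k G m)
    (lam : 'rV[k]_m -> 'M[k]_m) : Prop :=
  [/\ forall f, centgmx rP (lam f),
      forall f f', lam (f + f') = lam f + lam f',
      forall f A, centgmx rP A -> lam (f *m A) = lam f *m A &
      forall u f, u \in N -> lam (f *m rP u^-1%g) = (chi u)^-1 *: lam f].

Definition whit_form_generator m (rP : mx_representation k G m)
    (lam : 'rV[k]_m -> 'M[k]_m) : Prop :=
  whit_form rP lam /\
  forall mu, whit_form rP mu ->
    exists A, centgmx rP A /\ forall f, mu f = lam f *m A.

Lemma centgmx_commutes m (rP : mx_representation k G m) A :
  centgmx rP A <-> commutes A rP.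
Proof.
split=> [/centgmxP cA g | cA]; first by rewrite cA ?inE.
by apply/centgmxP=> g _; apply: cA.
Qed.

Variable H : gT -> k.
Hypothesis HN : forall u g, u \in N -> H (u * g)%g = chi u * H g.
Local Notation Hop := (\sum_g H g *: aG g^-1%g).
Hypothesis Horth :
  forall d (rV : mx_representation k G d),
     mx_irreducible rV -> whit_op rV != 0 ->
     forall m (rP : mx_representation k G m) (phi : 'M[k]_(m, d)),
       projective_cover rV rP phi ->
       forall lam, whit_form_generator rP lam ->
       forall f, \sum_g H g *: lam (f *m rP g^-1%g) = 0.

Lemma primitive_orth E : hecke E -> E *m E = E ->
  (forall X, hecke X -> E *m X = X -> X *m X = X -> X = 0 \/ X = E) ->
  E *m Hop = 0.
Proof.
move=> hE EE Eprim.
have [r [a [b [abE baK]]]] := idem_base EE.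
(* The primitivity condition admits E = 0, which has no irreducible quotient to offer. *)
have [r0|r_gt0] := posnP r.
  by move: a b abE {baK}; rewrite r0 => a b <-; rewrite thinmx0 !mul0mx.
pose rP := idem_repr hE abE baK.
have [d [rV [phi [irrV homphi fullphi]]]] := irreducible_quotient rP r_gt0.
apply: (@idem_form_orth E hE r a b abE baK H HN) => f.
have whitV : whit_op rV != 0.
  apply/negP=> /eqP w0; have := idem_cover_whit homphi.
  rewrite w0 mulmx0 => /esym/eqP; apply/negP.
  exact: (idem_gen_neq0 irrV homphi fullphi).
have cover := idem_projective_cover EE Eprim irrV homphi fullphi.
suff gen : whit_form_generator rP (idem_form a b).
  exact: (Horth irrV whitV cover gen f).
split=> [|mu [muR muD muM muJ]].
  split=> [g|||u g Nu]; first exact/centgmx_commutes/idem_form_comm.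
  - exact: idem_formD.
  - by move=> g A /centgmx_commutes; apply: idem_formM.
  - by rewrite idem_formJ ?groupV // chiV.
have [g||||A cA DA] := @idem_form_gen E hE r a b abE baK mu.
- exact/centgmx_commutes.
- exact: muD.
- by move=> g A /centgmx_commutes; apply: muM.
- by move=> u g Nu; rewrite -{1}[u]invgK muJ ?groupV // chiV // invrK.
by exists A; split; first exact/centgmx_commutes.
Qed.

Lemma idem_orth E : hecke E -> E *m E = E -> E *m Hop = 0.
Proof.
have [n] := ubnP (\rank E); elim: n E => // n IH E ltEn hE EE.
case: (classic (exists X, [/\ hecke X, E *m X = X, X *m X = X & X != 0 /\ X != E])).
  case=> X [hX EX XX [X0 XE]].
  have XEc : X *m E = X by rewrite hecke_mulC.
  (* At equal ranks [E] would be a left multiple of [Y], and then Y Z = 0 would force Z = E Z =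
     0. *)
  have lt_idem Y Z : Y *m E = Y -> E *m Z = Z -> Y *m Z = 0 -> Z != 0 ->
      (\rank Y < \rank E)%N.
    move=> YE EZ YZ; have leYE : (Y <= E)%MS by rewrite -YE submxMl.
    rewrite (ltn_leqif (mxrank_leqif_sup leYE)); apply: contra => /submxP[W DW].
    by rewrite -EZ DW -mulmxA YZ mulmx0.
  have X'0 : E - X != 0 by rewrite subr_eq0 eq_sym.
  have EX' : E *m (E - X) = E - X by rewrite mulmxBr EE EX.
  have X'E : (E - X) *m E = E - X by rewrite mulmxBl EE XEc.
  have XX' : X *m (E - X) = 0 by rewrite mulmxBr XEc XX subrr.
  have X'X : (E - X) *m X = 0 by rewrite mulmxBl EX XX subrr.
  have X'X' : (E - X) *m (E - X) = E - X by rewrite mulmxBr X'E X'X subr0.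
  have ltX := leq_trans (lt_idem _ _ _ _ XEc EX' XX' X'0) (ltEn : (\rank E <= n)%N).
  have ltX' := leq_trans (lt_idem _ _ _ _ X'E EX X'X X0) (ltEn : (\rank E <= n)%N).
  rewrite -[E](subrK X) mulmxDl (IH _ ltX) // (IH _ ltX') ?addr0 //.
  exact: heckeB.
move=> nex; apply: primitive_orth => // X hX EX XX.
have [->|X0] := eqVneq X 0; first by left.
have [->|XE] := eqVneq X E; first by right.
by case: nex; exists X; split.
Qed.

Lemma gring_index_inj : injective (gring_index G).
Proof. by move=> x y /(congr1 enum_val); rewrite !gring_indexK ?inE. Qed.

Lemma whit_orth0 y : H y = 0.
Proof.
have coefH x : (gdelta k x *m Hop) 0 (gring_index G 1%g) = H x.
  rewrite mulmx_sumr summxE (bigD1 x) //= -scalemxAr gdelta_repr mulgV.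
  rewrite !mxE !eqxx mulr1 big1 ?addr0 // => g ne_gx.
  rewrite -scalemxAr gdelta_repr !mxE (inj_eq gring_index_inj) eq_sym.
  rewrite -(inj_eq (mulIg g)) mulgKV mul1g eq_sym (negPf ne_gx).
  by rewrite mulr0.
have := idem_orth hecke_id whit_idemM.
move: coefH; set h := \sum_g _ => coefH; clearbody h.
move/(congr1 (fun A => (gdelta k y *m A) 0 (gring_index G 1%g))).
rewrite mulmx0 [RHS]mxE mulmxA gdelta_lmul -scalemxAr -!scalemxAl mulmx_sumr.
rewrite !mulmx_suml mxE summxE (eq_bigr (fun _ => H y)) => [|u Nu]; last first.
  rewrite -scalemxAr -!scalemxAl mxE !gdelta_repr mul1g coefH HN // mulrA.
  by rewrite mulVf ?chi_neq0 ?mul1r.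
by rewrite sumr_const -[H y *+ _]mulr_natl mulrA mulVf ?mul1r.
Qed.

End Hecke.

(** * Commutativity from an anti-involution *)

Section GelfandTrick.
Variables (k : fieldType) (gT : finGroupType).
Local Notation G := [set: gT]%G.
Local Notation nG := #|G|.
Local Notation aG := (regular_repr k G).
Local Notation d1 := (gdelta k (1%g : gT)).
Variables (N : {group gT}) (chi : gT -> k).
Hypothesis chiM : {in N &, forall u v, chi (u * v)%g = chi u * chi v}.
Hypothesis chi_neq0 : forall u, u \in N -> chi u != 0.
Hypothesis cardN_neq0 : (#|N|%:R : k) != 0.
Local Notation E0 := (whit_idem N chi).
Local Notation eps := (whit_op N chi aG).

Variable sigma : gT -> gT.
Hypothesis sigmaM : forall x y, sigma (x * y)%g = (sigma y * sigma x)%g.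
Hypothesis sigmaK : involutive sigma.
Hypothesis sigmaN : forall u, u \in N -> sigma u \in N.
Hypothesis chi_sigma : forall u, u \in N -> chi (sigma u) = chi u.
Hypothesis double_coset : forall x, exists u w v,
  [/\ x = (u * w * v)%g, u \in N, v \in N &
   sigma w = w \/
   exists u' v', [/\ u' \in N, v' \in N, (u' * w = w * v')%g & chi u' != chi v']].

Local Notation L x := (lmul (gdelta k (x : gT))).
Local Notation T x := (E0 *m L x *m E0).

Lemma lmul_gdeltaM x y : L x *m L y = L (y * x)%g.
Proof.
apply: eq_on_gdelta => z; rewrite mulmxA gdelta_lmul gdelta_repr.
by rewrite !gdelta_lmul !gdelta_repr mulgA.
Qed.

Lemma whit_opJr m (rP : mx_representation k G m) u : u \in N ->
  whit_op N chi rP *m rP u = chi u *: whit_op N chi rP.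
Proof.
move=> Nu; rewrite -scalemxAl scalerA mulrC -scalerA; congr (_ *: _).
rewrite mulmx_suml scaler_sumr (reindex_inj (mulIg u^-1%g)) /=.
rewrite (eq_bigl (mem N)) => [|v]; last by rewrite groupMr ?groupV.
apply: eq_bigr => v Nv; rewrite -scalemxAl -repr_mxM ?inE // mulgKV scalerA.
by rewrite chiM ?groupV // (chiV chiM) // invfM invrK mulrC.
Qed.

Lemma whit_idemE :
  E0 = (#|N|%:R)^-1 *: \sum_(u in N) (chi u)^-1 *: L u.
Proof.
apply: eq_on_gdelta => x; rewrite gdelta_lmul -!scalemxAr -scalemxAl.
congr (_ *: _); rewrite !mulmx_sumr mulmx_suml; apply: eq_bigr => u _.
by rewrite -!scalemxAr -scalemxAl gdelta_lmul !gdelta_repr mul1g.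
Qed.

Lemma whit_idem_mul u : u \in N -> E0 *m L u = chi u *: E0.
Proof.
move=> Nu; apply: eq_gdelta1; [apply: commutesM; apply: lmul_comm| |].
  by move=> g; rewrite -scalemxAl -scalemxAr lmul_comm.
rewrite -[RHS]scalemxAr mulmxA !gdelta1_whit -mulmxA.
rewrite -(commutes_whit_op _ _ (lmul_comm _)) // mulmxA gdelta1_lmul.
rewrite -[gdelta k u](_ : d1 *m aG u = _).
  by rewrite -mulmxA whit_opJ // scalemxAr.
by rewrite gdelta_repr mul1g.
Qed.

Lemma mul_whit_idem u : u \in N -> L u *m E0 = chi u *: E0.
Proof.
move=> Nu; apply: eq_gdelta1; [apply: commutesM; apply: lmul_comm| |].
  by move=> g; rewrite -scalemxAl -scalemxAr lmul_comm.
rewrite -[RHS]scalemxAr gdelta1_whit mulmxA gdelta1_lmul gdelta_lmul.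
by rewrite -mulmxA whit_opJr // scalemxAr.
Qed.

Lemma hecke_double_coset u x v : u \in N -> v \in N ->
  T (u * x * v)%g = (chi u * chi v) *: T x.
Proof.
move=> Nu Nv; rewrite -!lmul_gdeltaM !mulmxA whit_idem_mul //.
rewrite -(mulmxA _ (L u)) mul_whit_idem //.
by rewrite -!scalemxAl -scalemxAr scalerA mulrC.
Qed.

(** On a representative with u' w = w v' and distinct character values, chi(u') T w = chi(v') T w
    kills T w, and [sigma] transports the relation to sigma w. On the others [sigma] fixes w and
    only swaps the outer factors. *)
Lemma hecke_sigma x : T (sigma x) = T x.
Proof.
have [u [w [v [-> Nu Nv [sw|[u' [v' [Nu' Nv' eqw ne]]]]]]]] := double_coset x.
  rewrite !sigmaM sw mulgA (hecke_double_coset w Nu Nv).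
  rewrite (hecke_double_coset w (sigmaN Nv) (sigmaN Nu)).
  by rewrite !chi_sigma // mulrC.
have T0 y u1 v1 : u1 \in N -> v1 \in N -> (u1 * y = y * v1)%g ->
    chi u1 != chi v1 -> T y = 0.
  move=> N1 N2 e; rewrite -subr_eq0 => ne1.
  have := hecke_double_coset y N1 (group1 N).
  rewrite mulg1 e -[in LHS](mul1g y) (hecke_double_coset y (group1 N) N2).
  rewrite (chi1 chiM) // mul1r mulr1 => /esym/eqP.
  by rewrite -subr_eq0 -scalerBl scaler_eq0 (negPf ne1) => /eqP.
have Tw := T0 w _ _ Nu' Nv' eqw ne.
have Tsw : T (sigma w) = 0.
  apply: (T0 _ (sigma v') (sigma u')); rewrite ?sigmaN ?chi_sigma //.
    by rewrite -!sigmaM eqw.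
  by rewrite eq_sym.
rewrite !sigmaM mulgA (hecke_double_coset w Nu Nv).
rewrite (hecke_double_coset _ (sigmaN Nv) (sigmaN Nu)).
by rewrite Tw Tsw !scaler0.
Qed.

Lemma hecke_gen_mul x y :
  T x *m T y = (#|N|%:R)^-1 *: \sum_(u in N) (chi u)^-1 *: T (y * u * x)%g.
Proof.
have -> : T x *m T y = E0 *m L x *m E0 *m L y *m E0.
  by rewrite !mulmxA -(mulmxA _ E0 E0) whit_idemM.
rewrite {2}whit_idemE -scalemxAr -!scalemxAl; congr (_ *: _).
rewrite mulmx_sumr !mulmx_suml; apply: eq_bigr => u _.
rewrite -scalemxAr -!scalemxAl -!lmul_gdeltaM; congr (_ *: _).
by rewrite !mulmxA.
Qed.

(** Gelfand's trick: [sigma] reverses products yet fixes every T x. Replace both factors by their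
    [sigma] images, then reindex the middle average over N by [sigma]. *)
Lemma hecke_gen_mulC x y : T x *m T y = T y *m T x.
Proof.
rewrite -(hecke_sigma x) -(hecke_sigma y) hecke_gen_mul.
rewrite (hecke_sigma x) (hecke_sigma y) hecke_gen_mul; congr (_ *: _).
rewrite (reindex_inj (inv_inj sigmaK)) /=.
rewrite (eq_bigl (mem N)) => [|u]; last first.
  by apply/idP/idP=> /sigmaN; rewrite ?sigmaK.
apply: eq_bigr => u Nu; rewrite chi_sigma // -!sigmaM hecke_sigma.
by rewrite mulgA.
Qed.

Lemma hecke_mulC A B : hecke N chi A -> hecke N chi B -> A *m B = B *m A.
Proof.
have expand X : hecke N chi X ->
    X = \sum_i (d1 *m X) 0 i *: T (enum_val i).
  case=> cX lX rX; rewrite -{1}rX -{1}lX -{1}(lmulK cX).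
  rewrite {1}[d1 *m X]row_sum_delta.
  have lmul_sum (I : finType) (c : I -> k) (v : I -> 'rV_nG) :
      lmul (\sum_i c i *: v i) = \sum_i c i *: lmul (v i) :> 'M[k]_nG.
    apply: eq_on_gdelta => x; rewrite gdelta_lmul mulmx_suml mulmx_sumr.
    by apply: eq_bigr => i _; rewrite -scalemxAl -scalemxAr gdelta_lmul.
  rewrite lmul_sum mulmx_sumr mulmx_suml; apply: eq_bigr => i _.
  by rewrite -scalemxAr -scalemxAl /gdelta gring_valK.
move=> hA hB; rewrite (expand A hA) (expand B hB).
rewrite !mulmx_suml; under eq_bigr do rewrite mulmx_sumr.
under [RHS]eq_bigr do rewrite mulmx_sumr.
rewrite exchange_big /=; apply: eq_bigr => i _; apply: eq_bigr => j _.
by rewrite -!scalemxAl -!scalemxAr hecke_gen_mulC !scalerA mulrC.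
Qed.

End GelfandTrick.

(** * Unitriangular matrices and the Bruhat decomposition *)

Section Layered.
Local Open Scope nat_scope.

(* The hypothesis on consecutive values forces f to reverse consecutive blocks
   of integers; a block starting at s is read off backwards from f^-1 s. *)
Lemma layered_involution (T : Type) M (f : nat -> nat) (t : nat -> T) :
    (forall c, c < M -> f c < M) ->
    (forall c c', c < M -> c' < M -> f c = f c' -> c = c') ->
    (forall s, s < M -> exists2 c, c < M & f c = s) ->
    (forall c, c.+1 < M ->
       f c < f c.+1 \/ (f c = (f c.+1).+1 /\ t c.+1 = t c)) ->
  forall j, j < M -> f (f j) = j /\ t (f j) = t j.
Proof.
move=> fM finj fsurj fstep.
pose P s := forall j, j < s -> [/\ f j < s, f (f j) = j & t (f j) = t j].
have step s : s < M -> P s -> exists s', [/\ s < s', s' <= M & P s'].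
  move=> ltsM Ps; have [c ltcM fc] := fsurj s ltsM.
  have ge_s j : s <= j -> j < M -> s <= f j.
    move=> lesj ltjM; rewrite leqNgt; apply/negP=> ltfj.
    have [lt1 e1 _] := Ps _ ltfj.
    have := finj _ _ (ltn_trans lt1 ltsM) ltjM e1; lia.
  have lesc : s <= c.
    rewrite leqNgt; apply/negP=> ltcs; have [] := Ps c ltcs; lia.
  (* Going down from c, the value must rise by exactly one: a smaller value would lie between s and
     s + i - 1, all taken already, against injectivity. *)
  have run i : i <= c - s -> f (c - i) = s + i /\ t (c - i) = t c.
    elim/ltn_ind: i => -[_ _|i IH lei]; first by rewrite subn0 addn0.
    have [fi ti] := IH i (ltnSn i) (ltnW lei).
    have Ec : c - i = (c - i.+1).+1 by lia.
    have [|ltf|[ff tf]] := fstep (c - i.+1); first by lia.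
    - rewrite -Ec fi in ltf.
      have gef : s <= f (c - i.+1) by apply: ge_s; lia.
      have [||f2 _] := IH (f (c - i.+1) - s); try lia.
      rewrite subnKC // in f2.
      have := finj _ _ _ _ f2; lia.
    - by rewrite -Ec fi ti in ff tf; rewrite ff tf; split=> //; lia.
  exists c.+1; split=> // j; rewrite ltnS => lejc.
  have [ltjs|lesj] := ltnP j s.
    by have [h1 h2 h3] := Ps j ltjs; split=> //; lia.
  have [|f1 t1] := run (c - j); first by lia.
  have [|f2 t2] := run (j - s); first by lia.
  rewrite subKn // in f1 t1.
  have Efj : f j = c - (j - s) by lia.
  by rewrite Efj f2 t2 t1; split=> //; lia.
have PM : P M.
  have : forall d s, M - s <= d -> s <= M -> P s -> P M.
    elim=> [|d IH] s led lesM Ps; first by have <- : s = M by lia.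
    have [ltsM|gesM] := ltnP s M; last by have <- : s = M by lia.
    have [s' [lt1 le2 Ps']] := step s ltsM Ps.
    by apply: (IH s') => //; lia.
  by move/(_ M 0); apply=> //; lia.
by move=> j ltj; have [_ h1 h2] := PM j ltj.
Qed.

End Layered.

Section Unitriangular.
Variables (F : fieldType) (m : nat).
Implicit Types A B U V : 'M[F]_m.+1.

Definition unitri A := forall i j : 'I_m.+1,
  ((j < i)%N -> A i j = 0) /\ (i = j -> A i j = 1).

Definition supdiag A : F := \sum_(i < m) A (inord i) (inord i.+1).

Lemma unitri1 : unitri 1%:M.
Proof.
move=> i j; rewrite mxE; split=> [ltji|->]; last by rewrite eqxx.
by case: eqP ltji => // ->; rewrite ltnn.
Qed.

Lemma unitriM A B : unitri A -> unitri B -> unitri (A *m B).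
Proof.
move=> uA uB i j; rewrite mxE; split=> [ltji | <-].
  rewrite big1 // => l _; have [ltli|leil] := ltnP l i.
    by rewrite (uA i l).1 // mul0r.
  by rewrite (uB l j).1 ?mulr0 // (leq_trans ltji).
rewrite (bigD1 i) //= (uA i i).2 // (uB i i).2 // mulr1 big1 ?addr0 // => l ne.
have [ltli|leil] := ltnP l i; first by rewrite (uA i l).1 // mul0r.
rewrite (uB l i).1 ?mulr0 // ltn_neqAle leil andbT.
by apply: contra ne => /eqP e; apply/eqP/val_inj.
Qed.

Lemma supdiagM A B : unitri A -> unitri B ->
  supdiag (A *m B) = supdiag A + supdiag B.
Proof.
move=> uA uB; rewrite /supdiag -big_split /=; apply: eq_bigr => x _.
set i : 'I_m.+1 := inord x; set j : 'I_m.+1 := inord x.+1.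
have iE : i = x :> nat by rewrite inordK // ltnW // ltnS ltn_ord.
have jE : j = x.+1 :> nat by rewrite inordK // ltnS ltn_ord.
have neij : j != i by rewrite -val_eqE /= iE jE; lia.
clearbody i j; rewrite mxE (bigD1 i) //= (bigD1 j) //= (uA i i).2 // (uB j j).2 //.
rewrite mul1r mulr1 big1 => [|l /andP[neli nelj]].
  by rewrite addr0 addrC.
have [ltli|leil] := ltnP l i; first by rewrite (uA i l).1 // mul0r.
rewrite (uB l j).1 ?mulr0 //; move: neli nelj; rewrite -!val_eqE /= iE jE.
by rewrite iE in leil; lia.
Qed.

Lemma unitri_unit A : unitri A -> A \in unitmx.
Proof.
move=> uA; rewrite unitmxE -det_tr det_trig.
  by rewrite big1 ?unitr1 // => i _; rewrite mxE (uA i i).2.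
by apply/is_trig_mxP => i j ltij; rewrite mxE (uA j i).1.
Qed.

(** Each power of A - 1 moves the support up one more diagonal. With Frobenius this bounds the order
    of A in characteristic p. *)
Lemma unitri_nilp A : unitri A -> (A - 1) ^+ m.+1 = 0.
Proof.
move=> uA; have nil e : forall i j : 'I_m.+1, (j < i + e)%N -> ((A - 1) ^+ e) i j = 0.
  elim: e => [|e IH] i j lt.
    rewrite addn0 in lt; rewrite expr0 -[1]/(1%:M) mxE -val_eqE /=.
    by case: eqP lt => // ->; rewrite ltnn.
  rewrite exprSr mxE big1 // => l _; have [lt1|le1] := ltnP l (i + e).
    by rewrite IH // mul0r.
  have lejl : (j <= l)%N by lia.
  rewrite -[1]/(1%:M) !mxE; have [->|ne] := eqVneq l j.
    by rewrite (uA j j).2 // subrr mulr0.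
  rewrite (uA l j).1 ?sub0r ?mulr0n ?oppr0 ?mulr0 //.
  by rewrite ltn_neqAle lejl andbT eq_sym; apply: contra ne => /eqP/val_inj->.
by apply/matrixP=> i j; rewrite nil ?mxE // (leq_trans (ltn_ord j)) // leq_addl.
Qed.

Definition elem (x y : 'I_m.+1) (b : F) : 'M[F]_m.+1 := 1%:M + b *: delta_mx x y.

Lemma elem_unitri (x y : 'I_m.+1) b : (x < y)%N -> unitri (elem x y b).
Proof.
move=> ltxy i j; have [h1 h2] := unitri1 i j; rewrite !mxE in h1 h2 *; split=> h.
  rewrite h1 // add0r; case: eqP => [ix|_]; last by rewrite mulr0.
  case: eqP => [jy|_]; last by rewrite mulr0.
  by move: ltxy; rewrite -ix -jy ltnNge ltnW.
rewrite h2 // h; case: eqP => [ix|_]; last by rewrite mulr0 addr0.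
case: eqP => [jy|_]; last by rewrite mulr0 addr0.
by move: ltxy; rewrite -ix -jy ltnn.
Qed.

Lemma supdiag_elem (x y : 'I_m.+1) b : (x < y)%N ->
  supdiag (elem x y b) = if y == x.+1 :> nat then b else 0.
Proof.
move=> ltxy.
have E (i : 'I_m) : elem x y b (inord i) (inord i.+1) =
    if (i == x :> nat) && (y == x.+1 :> nat) then b else 0.
  have lti := ltn_ord i.
  rewrite !mxE -!val_eqE /= !inordK //; last by lia.
  have -> : (i == i.+1 :> nat) = false by lia.
  rewrite add0r; have [->|ne] := eqVneq (i : nat) x; last by rewrite mulr0.
  by rewrite eq_sym /=; case: eqP; rewrite ?mulr1 ?mulr0.
rewrite /supdiag (eq_bigr _ (fun i _ => E i)).
have [e|ne] := eqVneq (y : nat) x.+1; last first.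
  by rewrite big1 // => i _; rewrite andbF.
have ltxm : (x < m)%N by have := ltn_ord y; lia.
rewrite (bigD1 (Ordinal ltxm)) //= eqxx /= big1 ?addr0 // => i ne.
by rewrite andbT; case: eqP => // e1; case/eqP: ne; apply: val_inj.
Qed.

(** A matrix with a pivot in every column is monomial. *)
Definition pivot A (r c : 'I_m.+1) :=
  [/\ A r c != 0, forall i, i != r -> A i c = 0 & forall l, l != c -> A r l = 0].

(** Unitriangular factors allow only upward row operations and rightward column operations. The
    lowest nonzero entry of column [c] can thus clear its column, and its row to the right; to the
    left that row is already zero, because the earlier pivots lie in other rows. *)
Lemma elimination_step A (c : 'I_m.+1) : A \in unitmx ->
    (forall l : 'I_m.+1, (l < c)%N -> exists r, pivot A r l) ->
  exists U V, [/\ unitri U, unitri V &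
    forall l : 'I_m.+1, (l <= c)%N -> exists r, pivot (U *m A *m V) r l].
Proof.
move=> Aun piv.
have [r0 r0P] : exists r, A r c != 0.
  apply: NNPP => nex; have Ac : A *m delta_mx c (0 : 'I_1) = 0.
    rewrite -colE; apply/colP=> i; rewrite !mxE.
    by apply/eqP; rewrite -[_ == _]negbK; apply/negP=> ne; apply: nex; exists i.
  have := mulKmx Aun (delta_mx c (0 : 'I_1)); rewrite Ac mulmx0 => /colP/(_ c).
  by rewrite !mxE eqxx => /esym/eqP; rewrite oner_eq0.
pose r := [arg max_(i > r0 | A i c != 0) (i : nat)].
have [Arc rmax] : A r c != 0 /\ forall i, A i c != 0 -> (i <= r)%N.
  by rewrite /r; case: arg_maxnP => //= i Ai imax; split=> // j; apply: imax.
have A0 (i : 'I_m.+1) : (r < i)%N -> A i c = 0.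
  by move=> lt; apply/eqP; apply: contraLR lt => /rmax; rewrite -leqNgt.
clearbody r; pose x (i : 'I_m.+1) := if (i < r)%N then A i c / A r c else 0.
pose y (l : 'I_m.+1) := if (c < l)%N then A r l / A r c else 0.
pose U := \matrix_(i, l) ((i == l)%:R - (l == r)%:R * x i) : 'M[F]_m.+1.
pose V := \matrix_(i, l) ((i == l)%:R - (i == c)%:R * y l) : 'M[F]_m.+1.
have uU : unitri U.
  move=> i j; rewrite mxE; split=> [lt|->].
    have -> : (i == j) = false by apply/eqP=> e; rewrite e ltnn in lt.
    rewrite /x; case: eqP => [e|_]; last by rewrite mul0r subr0.
    by rewrite -e ltnNge (ltnW lt) /= mulr0 subr0.
  rewrite eqxx /x; case: eqP => [->|_]; last by rewrite mul0r subr0.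
  by rewrite ltnn mulr0 subr0.
have uV : unitri V.
  move=> i j; rewrite mxE; split=> [lt|->].
    have -> : (i == j) = false by apply/eqP=> e; rewrite e ltnn in lt.
    rewrite /y; case: eqP => [e|_]; last by rewrite mul0r subr0.
    by rewrite -e ltnNge (ltnW lt) /= mulr0 subr0.
  rewrite eqxx /y; case: eqP => [->|_]; last by rewrite mul0r subr0.
  by rewrite ltnn mulr0 subr0.
have UA i l : (U *m A) i l = A i l - x i * A r l.
  rewrite mxE (eq_bigr (fun j => (i == j)%:R * A j l - (j == r)%:R * (x i * A j l))).
    rewrite sumrB (bigD1 i) //= eqxx mul1r big1 ?addr0; last first.
      by move=> j ne; rewrite eq_sym (negPf ne) mul0r.
    rewrite (bigD1 r) //= eqxx mul1r big1 ?addr0 // => j ne.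
    by rewrite (negPf ne) mul0r.
  by move=> j _; rewrite mxE mulrBl !mulrA.
have MV B i l : (B *m V) i l = B i l - B i c * y l.
  rewrite mxE (eq_bigr (fun j => (j == l)%:R * B i j - (j == c)%:R * (B i j * y l))).
    rewrite sumrB (bigD1 l) //= eqxx mul1r big1 ?addr0; last first.
      by move=> j ne; rewrite (negPf ne) mul0r.
    rewrite (bigD1 c) //= eqxx mul1r big1 ?addr0 // => j ne.
    by rewrite (negPf ne) mul0r.
  by move=> j _; rewrite mxE mulrBr mulrC; congr (_ - _); rewrite mulrCA.
have xr : x r = 0 by rewrite /x ltnn.
have yc : y c = 0 by rewrite /y ltnn.
have Ar0 (l : 'I_m.+1) : (l < c)%N -> A r l = 0.
  move=> lt; have [q [Aq Aq1 Aq2]] := piv l lt; apply: Aq1.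
  apply/eqP=> e; move: Arc; rewrite e Aq2 ?eqxx //.
  by apply/eqP=> e2; rewrite e2 ltnn in lt.
have Bc i : i != r -> (U *m A) i c = 0.
  move=> ne; rewrite UA /x; case: ltnP => [lt|ge]; first by rewrite divfK // subrr.
  rewrite mul0r subr0 A0 // ltn_neqAle ge andbT eq_sym.
  by apply: contra ne => /eqP/val_inj->.
exists U, V; split=> // l; rewrite leq_eqVlt => /orP[/eqP/val_inj-> | ltlc].
  exists r; split=> [|i ne|l' ne].
  - by rewrite MV UA xr yc mul0r mulr0 !subr0.
  - by rewrite MV Bc // mul0r subr0.
  rewrite MV !UA xr !mul0r !subr0 /y; case: ltnP => [lt|ge].
    by rewrite mulrC divfK // subrr.
  rewrite mulr0 subr0 Ar0 // ltn_neqAle ge andbT.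
  by apply: contra ne => /eqP/val_inj->.
have [q [Aq Aq1 Aq2]] := piv l ltlc.
have necl : c != l by apply/eqP=> e; rewrite e ltnn in ltlc.
have neqr : q != r by apply/eqP=> e; rewrite -e Aq2 ?eqxx // in Arc.
have xq : x q = 0 by rewrite /x Aq2 // mul0r if_same.
exists q; split=> [|i ne|l' ne].
- by rewrite MV Bc // UA xq !mul0r !subr0.
- have y0 : y l = 0 by rewrite /y ltnNge (ltnW ltlc).
  by rewrite MV y0 mulr0 subr0 UA Aq1 // Ar0 // mulr0 subr0.
by rewrite MV Bc // mul0r subr0 UA xq mul0r subr0 Aq2.
Qed.

Lemma bruhat A : A \in unitmx -> exists U V, [/\ unitri U, unitri V &
  forall c, exists r, pivot (U *m A *m V) r c].
Proof.
move=> Aun.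
have main d : (d <= m.+1)%N -> exists U V, [/\ unitri U, unitri V &
    forall l : 'I_m.+1, (l < d)%N -> exists r, pivot (U *m A *m V) r l].
  elim: d => [|d IH] ltd.
    by exists 1%:M, 1%:M; split=> //; apply: unitri1.
  have [U [V [uU uV piv]]] := IH (ltnW ltd).
  have Bun : U *m A *m V \in unitmx.
    by rewrite !unitmx_mul Aun !unitri_unit.
  have [U' [V' [uU' uV' piv']]] := elimination_step (c := Ordinal ltd) Bun piv.
  exists (U' *m U), (V *m V'); split; try exact: unitriM.
  by move=> l ltl; have := piv' l ltl; rewrite !mulmxA.
have [U [V [uU uV piv]]] := main m.+1 (leqnn _).
by exists U, V; split=> // c; apply: piv.
Qed.

(** This is w0 A^T w0, reflection in the antidiagonal: transposition reverses products, and w0 makes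
    the result upper triangular again. *)
Definition antitr A : 'M[F]_m.+1 := \matrix_(i, j) A (rev_ord j) (rev_ord i).

Lemma antitrM A B : antitr (A *m B) = antitr B *m antitr A.
Proof.
apply/matrixP=> i j; rewrite !mxE (reindex_inj rev_ord_inj) /=.
by apply: eq_bigr => l _; rewrite !mxE mulrC.
Qed.

Lemma antitrK : involutive antitr.
Proof. by move=> A; apply/matrixP=> i j; rewrite !mxE !rev_ordK. Qed.

Lemma antitr1 : antitr 1%:M = 1%:M.
Proof.
apply/matrixP=> i j; rewrite !mxE (inj_eq rev_ord_inj) eq_sym //.
Qed.

Lemma antitr_unit A : A \in unitmx -> antitr A \in unitmx.
Proof.
move=> Aun; have := antitrM A (invmx A).
by rewrite mulmxV // antitr1 => /esym/mulmx1_unit[].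
Qed.

Lemma antitr_unitri A : unitri A -> unitri (antitr A).
Proof.
move=> uA i j; rewrite mxE; split=> [lt|->]; last by rewrite (uA _ _).2.
by rewrite (uA _ _).1 //=; have := ltn_ord i; lia.
Qed.

Lemma supdiag_antitr A : supdiag (antitr A) = supdiag A.
Proof.
rewrite /supdiag (reindex_inj rev_ord_inj) /=; apply: eq_bigr => i _.
have lti := ltn_ord i.
by rewrite mxE; congr (A _ _); apply: val_inj; rewrite /= !inordK; lia.
Qed.

(* In the first case the nonzero entries of A form scalar blocks along the
   antidiagonal; in the second, u and v are elementary matrices. *)
Lemma monomial_dichotomy A (psi : F -> Prop) :
    (forall c, exists r, pivot A r c) ->
    (forall s : F, s != 0 -> (forall a, psi (s * a - a)) -> s = 1) ->
    (forall s : F, s != 0 -> ~ forall a, psi (s * a)) ->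
  antitr A = A \/
  exists u v, [/\ unitri u, unitri v, u *m A = A *m v &
                  ~ psi (supdiag u - supdiag v)].
Proof.
move=> piv psi1 psi0.
have [r rP] := fin_all_exists piv.
pose t c := A (r c) c.
have t0 c : t c != 0 by have [] := rP c.
have AE i l : A i l = if i == r l then t l else 0.
  by case: eqP => [->|/eqP ne] //; have [_ h _] := rP l; apply: h.
have rinj : injective r.
  move=> c c' e; apply/eqP; rewrite -[_ == _]negbK; apply/negP=> ne.
  have [_ _ h] := rP c'; have := t0 c; rewrite /t e h ?eqxx //.
(* The monomial matrix carries position (c, c') to (r c, r c'); the coefficient makes both
   correction terms have the single entry a * t c, at row r c and column c'. *)
have comm c c' a : elem (r c) (r c') (a * t c / t c') *m A = A *m elem c c' a.
  rewrite /elem mulmxDl mulmxDr mul1mx mulmx1; congr (_ + _).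
  rewrite -scalemxAl -scalemxAr; apply/matrixP=> i l; rewrite !mxE.
  rewrite (bigD1 (r c')) //= big1 ?addr0; last first.
    by move=> j ne; rewrite mxE (negPf ne) andbF mul0r.
  rewrite [in RHS](bigD1 c) //= [X in _ = _ * (_ + X)]big1 ?addr0; last first.
    by move=> j ne; rewrite mxE (negPf ne) mulr0.
  rewrite !mxE !eqxx andbT !AE (inj_eq rinj) /= eq_sym [in RHS]eq_sym.
  have [->|] := eqVneq l c'; last by rewrite !mulr0.
  rewrite eq_sym mulr1; case: (i == r c); last by rewrite mul0r !mulr0.
  by rewrite mul1r divfK.
case: (classic (exists u v, [/\ unitri u, unitri v, u *m A = A *m v &
                  ~ psi (supdiag u - supdiag v)])) => [|nex]; [by right|left].
have all_psi (c c' : 'I_m.+1) a : (c' = c.+1 :> nat) -> (r c < r c')%N ->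
    psi ((if r c' == (r c).+1 :> nat then a * t c / t c' else 0) - a).
  move=> e ltr; apply: NNPP => np; apply: nex.
  have ltc : (c < c')%N by rewrite e.
  exists (elem (r c) (r c') (a * t c / t c')), (elem c c' a); split.
  - exact: elem_unitri.
  - exact: elem_unitri.
  - exact: comm.
  by rewrite !supdiag_elem // e eqxx.
(* If the row increases by more than one, [psi] would hold at every -a; if it increases by exactly
   one, [psi1] forces the ratio of the two entries to be 1. *)
have dich (c c' : 'I_m.+1) : (c' = c.+1 :> nat) ->
    (r c' < r c)%N \/ (r c' = (r c).+1 :> nat /\ t c' = t c).
  move=> e; case: (ltngtP (r c') (r c)) => [|ltr|er]; first by left.
    right; have h := fun a => all_psi c c' a e ltr.
    have [er|ner] := eqVneq (r c' : nat) (r c).+1.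
      split=> //; have := psi1 (t c / t c').
      rewrite mulf_neq0 ?invr_eq0 // => /(_ isT) h1.
      have : t c / t c' = 1.
        apply: h1 => a; have := h a; rewrite er eqxx.
        by rewrite -mulrA mulrC.
      by move/(canRL (divfK (t0 _))); rewrite mul1r.
    case: (psi0 (-1)); first by rewrite oppr_eq0 oner_eq0.
    by move=> a; have := h a; rewrite (negPf ner) sub0r mulN1r.
  by have := rinj _ _ (val_inj er) => e2; rewrite e2 in e; lia.
(* Reversing the rows turns this dichotomy into the hypothesis of [layered_involution]; that f is an
   involution preserving the entries is precisely symmetry in the antidiagonal. *)
pose f (j : nat) : nat := rev_ord (r (inord j)).
pose tn (j : nat) := t (inord j).
have fE (j : 'I_m.+1) : f j = rev_ord (r j) :> nat by rewrite /f inord_val.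
have lay : forall j, (j < m.+1)%N -> f (f j) = j /\ tn (f j) = tn j.
  apply: layered_involution
    => [c _|c c' ltc ltc' /val_inj/rev_ord_inj/rinj e|s lts|c ltc].
  - exact: ltn_ord.
  - by have := congr1 (@nat_of_ord _) e; rewrite !inordK.
  - exists (invF rinj (rev_ord (inord s))); first exact: ltn_ord.
    by rewrite fE f_invF rev_ordK inordK.
  have ltc0 : (c < m.+1)%N by apply: ltnW.
  have e : (inord c.+1 : 'I_m.+1) = (inord c : 'I_m.+1).+1 :> nat.
    by rewrite !inordK.
  have l1 := ltn_ord (r (inord c)); have l2 := ltn_ord (r (inord c.+1)).
  have [h|[h1 h2]] := dich _ _ e; [left|right]; rewrite /f /=; first by lia.
  by split; [lia | exact: h2].
have rho j : rev_ord (r (rev_ord (r j))) = j.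
  by apply: val_inj; have [h _] := lay j (ltn_ord j); rewrite fE fE in h.
have trho j : t (rev_ord (r j)) = t j.
  by have [_ h] := lay j (ltn_ord j); rewrite fE /tn !inord_val in h.
apply/matrixP=> i j; rewrite mxE !AE.
have -> : (rev_ord j == r (rev_ord i)) = (i == r j).
  rewrite -(inj_eq rev_ord_inj) rev_ordK; apply/eqP/eqP=> [-> | ->].
    by have := rho (rev_ord i) => /(congr1 (@rev_ord _)); rewrite !rev_ordK.
  by rewrite rho.
by case: eqP => // ->; rewrite trho.
Qed.

End Unitriangular.

(** * The general linear group *)

Lemma sum_rcosets (V : nmodType) (gT : finGroupType) (N : {group gT})
    (f : gT -> V) : (forall u g, u \in N -> f (u * g)%g = f g) ->
  \sum_g f g = (\sum_(C in rcosets N [set: gT]) f (repr C)) *+ #|N|.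
Proof.
move=> fN; rewrite (eq_bigl (fun g => g \in [set: gT])) => [|g]; last by rewrite inE.
have part := rcosets_partition (subsetT N).
rewrite (set_partition_big _ part) /=.
rewrite -sumrMnl; apply: eq_bigr => C /rcosetsP[x _ ->].
rewrite (eq_bigr (fun _ => f (repr (N :* x)%g))) => [|g].
  by rewrite sumr_const card_rcoset.
have := mem_repr_rcoset N x; rewrite mem_rcoset => /(fN _ x); rewrite mulgKV => ->.
by rewrite mem_rcoset => /(fN _ x); rewrite mulgKV => ->.
Qed.

Section GeneralLinear.
Variables (F : finFieldType) (m : nat).
Local Notation gT := {'GL_m.+1[F]}.
Local Notation N := (unipN F m.+1).

(** Singular matrices fall to the default 1; only invertible ones are ever passed. *)
Definition mkGL (A : 'M[F]_m.+1) : gT := insubd (1%g : gT) A.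

Lemma mkGLK A : A \in unitmx -> GLval (mkGL A) = A.
Proof. by move=> uA; rewrite /mkGL [LHS]val_insubd uA. Qed.

Lemma GLval_inj : injective (@GLval m.+1 F).
Proof. exact: val_inj. Qed.

Lemma mem_unipN (u : gT) : u \in N <-> unitri (GLval u).
Proof.
rewrite inE; split=> [/forallP uN i j | uN].
  have /forallP/(_ j)/andP[/implyP h1 /implyP h2] := uN i.
  by split=> [/h1/eqP | /eqP/h2/eqP].
apply/forallP=> i; apply/forallP=> j; apply/andP; split; apply/implyP.
  by move=> lt; apply/eqP; apply: (uN i j).1.
by move=> /eqP e; apply/eqP; apply: (uN i j).2.
Qed.

Lemma unipN_group_set : group_set N.
Proof.
apply/group_setP; split; first by apply/mem_unipN; apply: unitri1.
by move=> x y /mem_unipN ux /mem_unipN uy; apply/mem_unipN; apply: unitriM.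
Qed.
Canonical unipN_group := Group unipN_group_set.

Lemma mkGL_unipN A : unitri A -> mkGL A \in N.
Proof. by move=> uA; apply/mem_unipN; rewrite mkGLK ?unitri_unit. Qed.

(** In characteristic p, x^(p^e) = 1 + (x - 1)^(p^e), which is 1 once p^e exceeds the nilpotency
    bound; Cauchy's theorem then excludes other prime divisors of |N|. *)
Lemma unipN_pgroup p : p \in [pchar F] -> (p.-group N)%g.
Proof.
move=> p_char; have pchM : p \in [pchar 'M[F]_m.+1].
  rewrite inE (pcharf_prime p_char) /=.
  by rewrite -scaler_nat (pcharf0 p_char) scale0r.
apply/pgroupP=> l l_pr /Cauchy[] // x Nx ox.
have /mem_unipN/unitri_nilp nil := Nx.
have p_pr := pcharf_prime p_char.
have pow e : (GLval x) ^+ (p ^ e) = 1 + (GLval x - 1) ^+ (p ^ e).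
  elim: e => [|e IH]; first by rewrite !expr1 addrC subrK.
  rewrite expnSr !exprM IH -(pFrobenius_autE pchM) pFrobenius_autD_comm.
    by rewrite pFrobenius_aut1.
  exact: commr_sym (commr1 _).
have x1 : (x ^+ (p ^ m.+1)%N)%g = 1%g.
  apply: GLval_inj.
  have -> : GLval (x ^+ (p ^ m.+1)%N)%g = (GLval x) ^+ (p ^ m.+1).
    by elim: (p ^ m.+1)%N => [|e IH] //; rewrite expgS exprS -IH.
  rewrite pow; have /subnKC <- : (m.+1 <= p ^ m.+1)%N.
    by apply: ltnW; apply: ltn_expl; apply: prime_gt1.
  by rewrite exprD nil mul0r addr0.
have := order_dvdn x (p ^ m.+1); rewrite ox x1 eqxx.
by rewrite Euclid_dvdX // andbT dvdn_prime2 // => /eqP->.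
Qed.

Lemma card_unipN_neq0 (k : fieldType) p l :
  p \in [pchar F] -> l \in [pchar k] -> l != p -> (#|N|%:R : k) != 0.
Proof.
move=> p_char l_char ne; rewrite -(dvdn_pcharf l_char).
have /pgroupP pN := unipN_pgroup p_char.
by apply: contra ne => /pN; apply; apply: pcharf_prime l_char.
Qed.

Variables (k : fieldType) (psi : F -> k).
Hypothesis psi_add : forall a b : F, psi (a + b) = psi a * psi b.
Hypothesis psi_unit : forall a : F, psi a != 0.
Hypothesis psi_nontriv : exists a : F, psi a != 1.
Hypothesis cardN_neq0 : (#|N|%:R : k) != 0.
Local Notation chi := (@psiN F k psi m.+1).

Lemma psi0 : psi 0 = 1.
Proof. by apply: (mulfI (psi_unit 0)); rewrite -psi_add addr0 mulr1. Qed.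

Lemma psiB a b : psi (a - b) = psi a / psi b.
Proof. by apply: (mulIf (psi_unit b)); rewrite divfK // -psi_add subrK. Qed.

Lemma chiE (u : gT) : chi u = psi (supdiag (GLval u)).
Proof. by []. Qed.

Lemma psiN_mul : {in N &, forall u v, chi (u * v)%g = chi u * chi v}.
Proof.
move=> u v /mem_unipN uu /mem_unipN uv.
by rewrite !chiE GL_MxE supdiagM // psi_add.
Qed.

Lemma psiN_neq0 u : u \in N -> chi u != 0.
Proof. by move=> _; apply: psi_unit. Qed.

Definition GLantitr (u : gT) : gT := mkGL (antitr (GLval u)).

Lemma GLantitrE (u : gT) : GLval (GLantitr u) = antitr (GLval u).
Proof. by rewrite mkGLK //; apply: antitr_unit; exact: (GL_unitmx u). Qed.

Lemma GL_hecke_mulC A B : hecke unipN_group chi A -> hecke unipN_group chi B ->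
  A *m B = B *m A.
Proof.
apply: (@hecke_mulC k gT unipN_group chi psiN_mul psiN_neq0 cardN_neq0
  GLantitr).
- by move=> x y; apply: GLval_inj; rewrite [RHS]GL_MxE !GLantitrE (GL_MxE x y) antitrM.
- by move=> x; apply: GLval_inj; rewrite !GLantitrE antitrK.
- by move=> u /mem_unipN uu; apply/mem_unipN; rewrite GLantitrE; apply: antitr_unitri.
- by move=> u _; rewrite !chiE GLantitrE supdiag_antitr.
move=> x; have [U [V [uU uV piv]]] := bruhat (GL_unitmx x).
have NU := mkGL_unipN uU; have NV := mkGL_unipN uV.
exists (mkGL U)^-1%g, (mkGL U * x * mkGL V)%g, (mkGL V)^-1%g.
split; rewrite ?groupV //; first by rewrite !mulgA mulVg mul1g mulgK.
have wE : GLval (mkGL U * x * mkGL V)%g = U *m GLval x *m V.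
  by rewrite !GL_MxE !mkGLK ?unitri_unit.
have trivial_psi s : s != 0 -> ~ forall a, psi (s * a) = 1.
  move=> s0 h; have [a /eqP] := psi_nontriv; apply.
  by rewrite -(mulVKf s0 a) h.
have [||sw|[u [v [uu uv uAv npsi]]]] :=
  monomial_dichotomy (psi := fun s => psi s = 1) piv.
- move=> s s0 h; apply/eqP; rewrite -subr_eq0; apply/negP=> /negP ne.
  by apply: (trivial_psi _ ne) => a; rewrite mulrBl mul1r.
- exact: trivial_psi.
- by left; apply: GLval_inj; rewrite GLantitrE wE.
right; exists (mkGL u), (mkGL v); split; try exact: mkGL_unipN.
  apply: GLval_inj; rewrite (GL_MxE (mkGL u)) (GL_MxE _ (mkGL v)) wE.
  by rewrite !mkGLK ?unitri_unit.
rewrite !chiE !mkGLK ?unitri_unit //; apply/negP=> /eqP e.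
by apply: npsi; rewrite psiB e divff.
Qed.

(* Conjugation by diag(1,-1,1,...) exchanges psi and psi^-1. *)
Lemma whit_op_generic d (rV : mx_representation k [set: gT]%G d) :
  whit_op unipN_group chi rV != 0 -> generic psi rV.
Proof.
move=> w0; pose D : 'M[F]_m.+1 := \matrix_(i, j) ((-1) ^+ i *+ (i == j)).
have DD : D *m D = 1%:M.
  apply/matrixP=> i j; rewrite !mxE (bigD1 i) //= big1 ?addr0 => [|l ne].
    rewrite !mxE eqxx mulr1n; case: eqP => [->|_]; last by rewrite mulr0n mulr0.
    by rewrite !mulr1n -expr2 sqrr_sign.
  by rewrite !mxE eq_sym (negPf ne) mulr0n mul0r.
have Dun : D \in unitmx by case/mulmx1_unit: DD.
pose t := mkGL D.
have conjE (u : gT) i j :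
    GLval (u ^ t)%g i j = (-1) ^+ i * GLval u i j * (-1) ^+ j.
  have tV : t^-1%g = t.
    by apply: (mulgI t); rewrite mulgV; apply: GLval_inj; rewrite GL_MxE !mkGLK.
  rewrite conjgE tV !GL_MxE !mkGLK // mulmxA.
  rewrite mxE (bigD1 j) //= [X in _ + X]big1 ?addr0 => [|l ne]; last first.
    by rewrite [D l j]mxE (negPf ne) mulr0n mulr0.
  rewrite [D j j]mxE eqxx mulr1n; congr (_ * _).
  rewrite mxE (bigD1 i) //= [X in _ + X]big1 ?addr0 => [|l ne]; last first.
    by rewrite [D i l]mxE eq_sym (negPf ne) mulr0n mul0r.
  by rewrite mxE eqxx mulr1n.
have Nt (u : gT) : u \in N -> (u ^ t)%g \in N.
  move=> /mem_unipN uu; apply/mem_unipN=> i j; rewrite conjE.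
  split=> [lt|<-]; first by rewrite (uu i j).1 // mulr0 mul0r.
  by rewrite (uu i i).2 // mulr1 -expr2 sqrr_sign.
have chit (u : gT) : chi (u ^ t)%g = (chi u)^-1.
  rewrite !chiE -[RHS]mul1r -psi0 -psiB sub0r; congr psi.
  rewrite /supdiag -sumrN; apply: eq_bigr => i _; rewrite conjE.
  have lti := ltn_ord i; rewrite mulrAC -exprD !inordK ?ltnS //; last exact: ltnW.
  by rewrite addnS -signr_odd /= addnn odd_double expr1 mulN1r.
have tt : (t * t)%g = 1%g by apply: GLval_inj; rewrite GL_MxE mkGLK.
have Nt' (u : gT) : ((u ^ t)%g \in N) = (u \in N).
  by apply/idP/idP=> [/Nt|/Nt //]; rewrite -conjgM tt conjg1.
pose W := \sum_(u in N) chi u *: rV u.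
have WE : W = rV t^-1%g *m (#|N|%:R *: whit_op unipN_group chi rV) *m rV t.
  rewrite /whit_op scalerA mulfV // scale1r mulmx_sumr mulmx_suml /W.
  rewrite (reindex_inj (conjg_inj t)); apply: eq_big => [u|u _]; first by rewrite Nt'.
  by rewrite chit -scalemxAr -scalemxAl -!repr_mxM ?inE // conjgE mulgA.
have W0 : W != 0.
  apply: contraNneq w0 => W0; move: WE; rewrite W0.
  move/(congr1 (fun X => rV t *m X *m rV t^-1%g)).
  rewrite mulmx0 mul0mx !mulmxA repr_mxK ?inE // -repr_mxM ?inE //.
  rewrite mulgV repr_mx1 mul1mx => /esym/eqP.
  by rewrite scaler_eq0 (negPf cardN_neq0).
(* Every relation defining the coinvariants is annihilated by [W] on the right, so their span lies
   in the kernel of a nonzero matrix. *)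
rewrite /generic; apply: (@leq_ltn_trans (\rank (kermx W))).
  apply: mxrankS; apply/sumsmx_subP=> u Nu; apply/sub_kermxP.
  rewrite mulmxBl mul_scalar_mx /W mulmx_sumr scaler_sumr.
  rewrite (reindex_inj (mulgI u)) /=.
  rewrite (eq_bigl (mem N)) => [|v]; last by rewrite groupMl.
  apply/eqP; rewrite subr_eq0; apply/eqP/eq_bigr => v Nv.
  by rewrite psiN_mul // -scalemxAr -repr_mxM ?inE // mulKg scalerA.
rewrite mxrank_ker.
have := mxrank_eq0 W; rewrite (negPf W0) => /negbT; rewrite -lt0n => h.
by have := rank_leq_row W; lia.
Qed.

End GeneralLinear.

Theorem theorem4p4
  (p : nat) (F : finFieldType) (p_char : p \in [pchar F])
  (l : nat) (l_prime : prime l) (l_neq_p : l != p)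
  (k : closedFieldType) (l_char : l \in [pchar k])
  (k_alg : forall x : k, exists e : nat, (0 < e)%N /\ x ^+ (l ^ e) = x)
  (n : nat) (n_gt0 : (0 < n)%N)
  (psi : F -> k)
  (psi_add : forall a b : F, psi (a + b) = psi a * psi b)
  (psi_unit : forall a : F, psi a != 0)
  (psi_nontriv : exists a : F, psi a != 1)
  (H : {'GL_n[F]} -> k) (H_Ind : in_Ind psi H)
  (Horth : forall d (rV : mx_representation k [set: {'GL_n[F]}] d),
     mx_irreducible rV -> generic psi rV ->
     forall m (rP : mx_representation k [set: {'GL_n[F]}] m) (phi : 'M[k]_(m, d)),
       projective_cover rV rP phi ->
       forall lam : 'rV[k]_m -> 'M[k]_m, coinv_dual_generator psi rP lam ->
       forall f : 'rV[k]_m,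
         \sum_(C in rcosets (unipN F n) [set: {'GL_n[F]}])
            H (repr C) *: whittaker rP lam f (repr C) = 0) :
  forall g, H g = 0.
Proof.
case: n n_gt0 H H_Ind Horth => [//|m] _ H HN Horth.
have cardN := card_unipN_neq0 m p_char l_char l_neq_p.
apply: (@whit_orth0 k _ (unipN_group F m) (@psiN F k psi m.+1)
  (psiN_mul psi_add) (psiN_neq0 psi_unit) cardN
  (GL_hecke_mulC psi_add psi_unit psi_nontriv cardN) H HN).
move=> d rV irrV whitV d' rP phi cover lam gen f.
have [[lamR lamD lamM lamJ] _] := gen.
have genV := whit_op_generic psi_add psi_unit cardN whitV.
have := Horth d rV irrV genV d' rP phi cover lam gen f.
(* The factor psi(u) from [H] cancels the inverse factor from [lam]: the summand is constant on
   cosets, and the sum over G is |N| times the given one. *)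
move=> orth; rewrite (@sum_rcosets _ _ (unipN_group F m)) => [|u g Nu].
  by rewrite [X in X *+ _]orth mul0rn.
rewrite HN // invMg repr_mxM ?inE // mulmxA lamJ // scalerA mulrAC.
by rewrite mulfV ?mul1r // psiN_neq0.
Qed.
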